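(* Let $G^+_{\mathrm{B_{ii}}}=\langle a,b,c \mid cbb=bba,\ ab=bc,\ ac=ca\rangle_{mo}$, with $\deg$ the word length. Its skew growth function is, as a formal power series in $t$, $$N_{G^{+}_{\mathrm{B_{ii}}},\deg}(t)=\frac{(1-t)^4}{1-t+t^2}.$$
   Context: $\langle L\mid R\rangle_{mo}$ denotes the monoid presented by a finite set of generators $L$ and relations $R$, i.e. the quotient of the free monoid $L^*$ by the congruence generated by $R$. All relations equate words of equal length, so the length of words gives a well-defined homomorphism $\deg:M\to\mathbb{Z}_{\ge 0}$. The monoid considered here is cancellative. Let $M=\langle L\mid R\rangle_{mo}$ be such a monoid. For $u,v\in M$ write $u|_l v$ if $v=ux$ for some $x\in M$. For a subset $J\subset M$ put $\mathrm{cm}_r(J)=\{u\in M: j|_l u \text{ for all } j\in J\}$, $\mathrm{min}_r(J)=\{u\in J: \text{every } v\in J \text{ with } v|_l u \text{ equals } u\}$, and $\mathrm{mcm}(J)=\mathrm{min}_r(\mathrm{cm}_r(J))$. A tower of $M$ of height $p\in\mathbb{Z}_{\ge0}$ is a sequence $T=(I_0,J_1,\dots,J_p)$ of subsets of $M$, where $I_0$ is the image of $L$ in $M$, such that, putting $I_k:=\mathrm{mcm}(J_k)$, for each $k=1,\dots,p$ one has $J_k\subset I_{k-1}$, $1<\#J_k<\infty$ and $I_k\neq\emptyset$. Put $|T|:=I_p$. $\mathrm{Tmcm}(M)$ is the set of all towers (including the height-$0$ tower $(I_0)$). The skew growth function is the formal power series $$N_{M,\deg}(t)=1+\sum_{T=(I_0,J_1,\dots,J_p)\in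 \mathrm{Tmcm}(M)}(-1)^{\#J_1+\cdots+\#J_p-p+1}\sum_{\Delta\in|T|}t^{\deg(\Delta)}.$$ *)

(* Defs.v *)
From HB Require Import structures.
From mathcomp Require Import all_boot all_order all_algebra finmap.
From mathcomp Require Import boolp classical_sets cardinality fsbigop.

Set Implicit Arguments.
Unset Strict Implicit.
Unset Printing Implicit Defensive.

Import GRing.Theory.

Local Open Scope classical_set_scope.
Local Open Scope quotient_scope.

Inductive congr_gen (L : eqType) (R : seq (seq L * seq L)) :
    seq L -> seq L -> Prop :=
| congr_gen_rel u v : (u, v) \in R -> congr_gen R u v
| congr_gen_refl u : congr_gen R u u
| congr_gen_sym u v : congr_gen R u v -> congr_gen R v u
| congr_gen_trans v u w : congr_gen R u v -> congr_gen R v w -> congr_gen R u w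
| congr_gen_cat u u' v v' :
    congr_gen R u u' -> congr_gen R v v' -> congr_gen R (u ++ v) (u' ++ v').

Section PresentedMonoid.
Variables (L : finType) (R : seq (seq L * seq L)).

Definition congr_genb : rel (seq L) := fun u v => `[< congr_gen R u v >].

Lemma congr_genb_refl : reflexive congr_genb.
Proof. by move=> u; apply/asboolP; exact: congr_gen_refl. Qed.

Lemma congr_genb_sym : symmetric congr_genb.
Proof. by move=> u v; apply/asboolP/asboolP; exact: congr_gen_sym. Qed.

Lemma congr_genb_trans : transitive congr_genb.
Proof.
move=> v u w /asboolP uv /asboolP vw; apply/asboolP.
exact: congr_gen_trans uv vw.
Qed.

Canonical congr_gen_equiv :=
  EquivRel congr_genb congr_genb_refl congr_genb_sym congr_genb_trans.

Definition pres_monoid := {eq_quot congr_gen_equiv}.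

HB.instance Definition _ := Choice.on pres_monoid.

Definition word_class (w : seq L) : pres_monoid := \pi_({eq_quot congr_gen_equiv}) w.

Definition pres_word (x : pres_monoid) : seq L :=
  repr (x : {eq_quot congr_gen_equiv}).

Lemma pres_wordK : cancel pres_word word_class.
Proof. by move=> x; rewrite /word_class /pres_word reprK. Qed.

Lemma word_classP u v : word_class u = word_class v <-> congr_gen R u v.
Proof.
rewrite /word_class; split => [/eqmodP/asboolP //|uv].
by apply/eqmodP/asboolP.
Qed.

Lemma congr_gen_word w : congr_gen R (pres_word (word_class w)) w.
Proof. by apply/word_classP; rewrite pres_wordK. Qed.

Definition pres_mul (x y : pres_monoid) : pres_monoid :=
  word_class (pres_word x ++ pres_word y).

Lemma word_class_cat u v :
  word_class (u ++ v) = pres_mul (word_class u) (word_class v).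
Proof.
apply/word_classP/congr_gen_sym.
by apply: congr_gen_cat; exact: congr_gen_word.
Qed.

Lemma pres_mulA : associative pres_mul.
Proof.
move=> x y z; rewrite -(pres_wordK x) -(pres_wordK y) -(pres_wordK z).
by rewrite -!word_class_cat catA.
Qed.

Lemma pres_mul1g : left_id (word_class [::]) pres_mul.
Proof. by move=> x; rewrite -(pres_wordK x) -word_class_cat. Qed.

Lemma pres_mulg1 : right_id (word_class [::]) pres_mul.
Proof. by move=> x; rewrite -(pres_wordK x) -word_class_cat cats0. Qed.

HB.instance Definition _ :=
  isMonoid.Build pres_monoid pres_mulA pres_mul1g pres_mulg1.

Lemma word_classM u v :
  word_class (u ++ v) = (word_class u * word_class v)%g.
Proof. exact: word_class_cat. Qed.

(* The length of an arbitrary representative; meaningful when all relations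
   equate words of equal length, see [deg_word_class]. *)
Definition deg (x : pres_monoid) : nat := size (pres_word x).

Definition generators : set pres_monoid := [set word_class [:: l] | l in setT].

Definition homogeneous : bool := all (fun r => size r.1 == size r.2) R.

Lemma congr_gen_size u v : homogeneous -> congr_gen R u v -> size u = size v.
Proof.
move=> /allP hR; elim=> {u v} // [u v /hR /eqP //|v u w _ -> _ -> //|u u' v v'].
by move=> _ uu' _ vv'; rewrite !size_cat uu' vv'.
Qed.

Lemma deg_word_class w : homogeneous -> deg (word_class w) = size w.
Proof. by move=> hR; exact: congr_gen_size (congr_gen_word w). Qed.

Lemma degM x y : homogeneous -> deg (x * y)%g = (deg x + deg y)%N.
Proof.
move=> hR; rewrite -(pres_wordK x) -(pres_wordK y) -word_classM.
by rewrite !deg_word_class // size_cat.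
Qed.

End PresentedMonoid.

Section CommonMultiples.
Variable M : monoidType.
Implicit Types (u v : M) (J : set M).

Definition dvdl u v : Prop := exists x, v = (u * x)%g.

Definition cm_r J : set M := [set u | forall j, J j -> dvdl j u].

Definition min_r J : set M :=
  [set u | J u /\ forall v, J v -> dvdl v u -> v = u].

Definition mcm J : set M := min_r (cm_r J).

End CommonMultiples.

Section Towers.
Variables (L : finType) (R : seq (seq L * seq L)).
Local Notation M := (pres_monoid R).

(* A tower (I_0, J_1, ..., J_p) is encoded by the sequence [:: J_1; ...; J_p],
   as I_0 is always the set of generators; J_k is [nth fset0 T k.-1]. *)
Definition tower_mcm (T : seq {fset M}) (k : nat) : set M :=
  if k is k'.+1 then mcm [set` nth fset0 T k'] else @generators L R.

Definition is_tower (T : seq {fset M}) : Prop :=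
  forall k, (k < size T)%N ->
    [/\ [set` nth fset0 T k] `<=` tower_mcm T k,
        (1 < #|` nth fset0 T k|)%N &
        tower_mcm T k.+1 !=set0].

Definition Tmcm : set (seq {fset M}) := [set T | is_tower T].

Definition tower_top (T : seq {fset M}) : set M := tower_mcm T (size T).

(* #J_1 + ... + #J_p - p + 1; the subtraction is never truncated on towers. *)
Definition tower_exponent (T : seq {fset M}) : nat :=
  ((\sum_(J <- T) #|` J|) - size T + 1)%N.

Local Open Scope ring_scope.

(* A formal power series is represented by its sequence of coefficients; the
   coefficient of t^n in t^(deg D) is [(deg D == n)%:R].  Both sums are sums
   over finite supports: see [finite_deg] and [finite_Tmcm_deg] below. *)
Definition skew_growth : nat -> int := fun n =>
  (n == 0%N)%:R +
  \sum_(T \in Tmcm)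
    (-1) ^+ tower_exponent T * \sum_(D \in tower_top T) ((deg D == n)%:R : int).

Local Close Scope ring_scope.

Lemma finite_deg (hR : homogeneous R) n : finite_set [set x : M | (deg x <= n)%N].
Proof.
pose f (p : {m : 'I_n.+1 & m.-tuple L}) : M := word_class R (tagged p).
have : finite_set (f @` setT) by apply: finite_image; exact: finite_finset.
apply: sub_finite_set => x /= xn.
have xn' : (size (pres_word x) < n.+1)%N by [].
exists (Tagged (fun m : 'I_n.+1 => m.-tuple L) (i := Ordinal xn')
  (in_tuple (pres_word x))) => //.
by rewrite /f /= pres_wordK.
Qed.

Lemma dvdl_trans (u v w : M) : dvdl u v -> dvdl v w -> dvdl u w.
Proof. by move=> [x ->] [y ->]; exists (x * y)%g; rewrite mulgA. Qed.

Lemma deg_dvdl (hR : homogeneous R) (u v : M) : dvdl u v -> (deg u <= deg v)%N.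
Proof. by move=> [x ->]; rewrite degM // leq_addr. Qed.

Lemma deg_eq0 (x : M) : deg x = 0%N -> x = 1%g.
Proof.
rewrite /deg => /eqP/nilP w0.
by rewrite -(pres_wordK x) w0.
Qed.

Lemma dvdl_deg_eq (hR : homogeneous R) (u v : M) :
  dvdl u v -> deg u = deg v -> u = v.
Proof.
move=> [x ->]; rewrite degM // => /esym/eqP.
by rewrite -{2}(addn0 (deg u)) eqn_add2l => /eqP/deg_eq0 ->; rewrite mulg1.
Qed.

Lemma tower_mcm_antichain (hR : homogeneous R) T k (u v : M) :
  tower_mcm T k u -> tower_mcm T k v -> dvdl u v -> u = v.
Proof.
case: k => [|k] /=; last by move=> [cu mu] [cv mv]; exact: mv.
move=> [l _ <-] [m _ <-] uv; apply: dvdl_deg_eq => //.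
by rewrite !deg_word_class.
Qed.

Lemma tower_dvdl T (hT : is_tower T) k D : (k <= size T)%N ->
  tower_mcm T k D ->
  forall i j, (i < k)%N -> j \in nth fset0 T i -> dvdl j D.
Proof.
elim: k D => [//|k IH] D kT [cD mD] i j.
rewrite ltnS leq_eqVlt => /orP[/eqP -> jk|ik ji]; first exact: cD.
have [JI J2 _] := hT _ kT.
have /fset0Pn[x xJ] : nth fset0 T k != fset0.
  by rewrite -cardfs_gt0; exact: ltn_trans J2.
apply: (@dvdl_trans _ x); last exact: cD.
by apply: IH ik ji; [exact: ltnW|exact: JI].
Qed.

Lemma tower_deg (hR : homogeneous R) T (hT : is_tower T) k D :
  (k <= size T)%N -> tower_mcm T k D -> (k < deg D)%N.
Proof.
elim: k D => [|k IH] D kT; first by move=> [l _ <-]; rewrite deg_word_class.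
move=> [cD mD]; have [JI J2 _] := hT _ kT.
have /fset0Pn[x xJ] : nth fset0 T k != fset0.
  by rewrite -cardfs_gt0; exact: ltn_trans J2.
have xD : dvdl x D by exact: cD.
have kx : (k < deg x)%N by apply: IH; [exact: ltnW|exact: JI].
rewrite ltnNge; apply/negP => Dk.
have xDE : x = D.
  apply: dvdl_deg_eq => //; apply/eqP; rewrite eqn_leq deg_dvdl //=.
  exact: leq_trans Dk kx.
suff J1 : nth fset0 T k = [fset x]%fset by rewrite J1 cardfs1 in J2.
apply/fsetP => y; rewrite inE; apply/idP/eqP => [yJ|-> //].
apply: (tower_mcm_antichain hR (JI _ yJ) (JI _ xJ)).
by rewrite xDE; exact: cD.
Qed.

Lemma finite_Tmcm_deg (hR : homogeneous R) n :
  finite_set [set T | Tmcm T /\ exists2 D, tower_top T D & (deg D <= n)%N].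
Proof.
pose B := fset_set [set x : M | (deg x <= n)%N].
pose F := fpowerset B.
pose f (p : {m : 'I_n.+1 & m.-tuple F}) : seq {fset M} := map val (tagged p).
have : finite_set (f @` setT) by apply: finite_image; exact: finite_finset.
apply: sub_finite_set => T /= [hT [D DT Dn]].
have sT : (size T < n.+1)%N.
  by rewrite ltnS; apply: ltnW; apply: leq_trans Dn; exact: (tower_deg hR hT).
have TF J : J \in T -> J \in F.
  move=> /(nthP fset0)[i iT <-]; rewrite fpowersetE; apply/fsubsetP => j jJ.
  rewrite in_fset_set ?inE /=; last exact: finite_deg.
  apply: leq_trans Dn; apply: deg_dvdl => //.
  exact: tower_dvdl DT _ _ iT jJ.
have [s sE] : exists s : seq F, map val s = T.
  elim: T TF {hT DT sT} => [|J T IH] TF; first by exists [::].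
  have [|s <-] := IH; first by move=> K KT; apply: TF; rewrite inE KT orbT.
  have JF : J \in F by apply: TF; rewrite mem_head.
  by exists ([` JF]%fset :: s).
have ss : (size s < n.+1)%N by rewrite -(size_map val) sE.
by exists (Tagged (fun m : 'I_n.+1 => m.-tuple F) (i := Ordinal ss) (in_tuple s)).
Qed.

End Towers.

Section FormalPowerSeries.
Variable A : comUnitRingType.
Local Open Scope ring_scope.
Implicit Types f g : nat -> A.

Definition fps_of_poly (p : {poly A}) : nat -> A := fun n => p`_n.

Definition fps_mul f g : nat -> A := fun n =>
  \sum_(i < n.+1) f i * g (n - i)%N.

(* The first n coefficients of the inverse of f, when f 0 is a unit. *)
Fixpoint fps_inv_seq f n : seq A :=
  if n is m.+1 then
    let s := fps_inv_seq f m in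
    rcons s ((f 0%N)^-1 * ((m == 0%N)%:R - \sum_(i < m) f (m - i)%N * s`_i))
  else [::].

Definition fps_inv f : nat -> A := fun n => (fps_inv_seq f n.+1)`_n.

Definition fps_div f g : nat -> A := fps_mul f (fps_inv g).

Lemma size_fps_inv_seq f n : size (fps_inv_seq f n) = n.
Proof. by elim: n => //= n IH; rewrite size_rcons IH. Qed.

Lemma nth_fps_inv_seq f n i : (i < n)%N -> (fps_inv_seq f n)`_i = fps_inv f i.
Proof.
elim: n => //= n IH; rewrite ltnS leq_eqVlt => /orP[/eqP ->//|lt_in].
by rewrite nth_rcons size_fps_inv_seq lt_in IH.
Qed.

Lemma fps_mulfV f : f 0%N \is a GRing.unit ->
  fps_mul f (fps_inv f) = fps_of_poly 1.
Proof.
move=> f0; apply/funext => n; rewrite /fps_mul /fps_of_poly coef1.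
rewrite big_ord_recl subn0 {1}/fps_inv /= nth_rcons size_fps_inv_seq ltnn eqxx.
rewrite mulrA divrr // mul1r [X in _ + X](reindex_inj rev_ord_inj) /=.
rewrite [X in _ + X](eq_bigr (fun i : 'I_n =>
  f (n - i)%N * (fps_inv_seq f n)`_i)) ?subrK // => i _.
by rewrite nth_fps_inv_seq // /bump /= add1n subnSK // subKn // ltnW.
Qed.

End FormalPowerSeries.

Definition gen_a : 'I_3 := Ordinal (isT : (0 < 3)%N).
Definition gen_b : 'I_3 := Ordinal (isT : (1 < 3)%N).
Definition gen_c : 'I_3 := Ordinal (isT : (2 < 3)%N).

Definition Bii_relations : seq (seq 'I_3 * seq 'I_3) :=
  [:: ([:: gen_c; gen_b; gen_b], [:: gen_b; gen_b; gen_a]);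
      ([:: gen_a; gen_b], [:: gen_b; gen_c]);
      ([:: gen_a; gen_c], [:: gen_c; gen_a])].

Lemma homogeneous_Bii : homogeneous Bii_relations.
Proof. by []. Qed.

(* [fps_div] by 1 - t + t^2 is a genuine division in Z[[t]]. *)
Lemma fps_mul_Bii_denom :
  let q := fps_of_poly (1 - 'X + 'X ^+ 2 : {poly int})%R in
  fps_mul q (fps_inv q) = fps_of_poly 1%R.
Proof. by apply: fps_mulfV; rewrite /fps_of_poly !coefE. Qed.

(* Main.v *)
(** Saito's inversion formula holds for every homogeneous left-cancellative
    monoid: the skew growth function is inverse to the growth function
    P(t) = sum of t^(deg u).  For a fixed u <> 1, the signed number of pairs
    (T, D) with D in |T| dividing u is -1; grouping the towers by height, this
    telescopes, because replacing T by all its extensions (T, J), where J runs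
    through the subsets of size at least 2 of the m >= 1 divisors of u in |T|,
    turns sign(T) into (1 - m) sign(T).

    In the monoid B_ii the conjugates of a by powers of b are a, c and one more
    element of the enveloping group; they commute and b permutes them
    cyclically.  So the monoid lies in Z^3 x| Z, with normal form
    a^i c^j b a^k b^(n-1), or a^i c^j when n = 0.  Left multiplication acts on
    (i, j, k, n) by a: i+1, c: j+1, b: (j, k, i, n+1), which gives left
    cancellation, and counting the normal forms by degree gives
    P(t) = (1 - t + t^2) / (1 - t)^4. *)

Require Import Defs.
From mathcomp Require Import all_boot all_order all_algebra.
From mathcomp Require Import finmap boolp classical_sets cardinality fsbigop.
From mathcomp Require Import zify.
Import GRing.Theory.
Set Implicit Arguments.
Unset Strict Implicit.
Unset Printing Implicit Defensive.
Local Open Scope classical_set_scope.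
Local Open Scope ring_scope.

(** * Arithmetic of formal power series *)

Section FpsRing.
Variable A : comUnitRingType.
Implicit Types (f g h : nat -> A) (p q : {poly A}).

(** Truncation lets the ring laws for [fps_mul] be read off from those of [{poly A}]. *)
Lemma fps_mul_poly m n f g : (n < m)%N ->
  fps_mul f g n = (\poly_(i < m) f i * \poly_(i < m) g i)`_n.
Proof.
move=> nm; rewrite coefM; apply: eq_bigr => i _.
by rewrite !coef_poly !(leq_ltn_trans _ nm) ?leq_subr // -ltnS.
Qed.

Lemma fps_mulC f g : fps_mul f g = fps_mul g f.
Proof. by apply/funext => n; rewrite !(@fps_mul_poly n.+1) // mulrC. Qed.

Lemma fps_mulA f g h : fps_mul f (fps_mul g h) = fps_mul (fps_mul f g) h.
Proof.
apply/funext => n.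
transitivity
    ((\poly_(i < n.+1) f i * (\poly_(i < n.+1) g i * \poly_(i < n.+1) h i))`_n).
  rewrite coefM; apply: eq_bigr => i _.
  by rewrite coef_poly ltn_ord (@fps_mul_poly n.+1) // ltnS leq_subr.
rewrite mulrA coefM; apply: eq_bigr => i _.
by rewrite coef_poly ltnS leq_subr (@fps_mul_poly n.+1).
Qed.

Lemma fps_mul_of_poly p q :
  fps_mul (fps_of_poly p) (fps_of_poly q) = fps_of_poly (p * q).
Proof. by apply/funext => n; rewrite /fps_mul /fps_of_poly coefM. Qed.

Lemma fps_mul1f f : fps_mul (fps_of_poly 1) f = f.
Proof.
apply/funext => n; rewrite /fps_mul /fps_of_poly big_ord_recl coef1 subn0 mul1r.
by rewrite big1 ?addr0 // => i _; rewrite coef1 mul0r.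
Qed.

Lemma fps_mul_sub1X0 f : fps_mul (fps_of_poly (1 - 'X)) f 0 = f 0%N.
Proof. by rewrite /fps_mul /fps_of_poly big_ord1 !coefE subr0 mul1r. Qed.

Lemma fps_mul_sub1XS f n :
  fps_mul (fps_of_poly (1 - 'X)) f n.+1 = f n.+1 - f n.
Proof.
rewrite /fps_mul /fps_of_poly !big_ord_recl big1 /= => [|i _].
  rewrite !coefE /= /bump /= !subr0 sub0r mul1r mulN1r addr0.
  by rewrite subn0 subSS subn0.
by rewrite !coefE /= subrr mul0r.
Qed.

(** The quotient of [f] by 1 - X. Running the index downwards puts the new term [f n] first, where
    [big_ord_recl] peels it off. *)
Definition partial_sums f : nat -> A := fun n => \sum_(i < n.+1) f (n - i)%N.

Lemma fps_mul_partial_sums f :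
  fps_mul (fps_of_poly (1 - 'X)) (partial_sums f) = f.
Proof.
apply/funext => -[|n].
  by rewrite fps_mul_sub1X0 /partial_sums big_ord1.
by rewrite fps_mul_sub1XS /partial_sums big_ord_recl subn0 addrK.
Qed.

End FpsRing.

(** Over all subsets the signs sum to (1 - 1)^|S| = 0; the excluded sizes 0 and 1 account for 1 -
    |S|. *)
Lemma sum_sign_fpowerset (K : choiceType) (S : {fset K}) : S != fset0 ->
  \sum_(J <- fpowerset S | (1 < #|` J|)%N) (-1) ^+ #|` J| =
  (#|` S|%:R - 1 : int).
Proof.
rewrite -cardfs_gt0 => S0.
(* Passing to [{set S}] over the finite type [S] gives access to the binomial count of subsets by
   size. *)
rewrite /fpowerset big_mkcond big_imfset /=; last first.
  move=> X Y _ _ /fsetP XY; apply/setP => x; have := XY (val x).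
  by rewrite !mem_imfset //; exact: val_inj.
have cI (X : {set S}) : #|` [fset val y | y in X]%fset| = #|X|.
  by rewrite card_imfset /= -?cardE //; exact: val_inj.
under eq_bigr => X _ do rewrite cI.
rewrite big_enum /=.
rewrite (eq_bigl predT) => [|X]; last by rewrite powersetE finset.subsetT.
pose F k : int := if (1 < k)%N then (-1) ^+ k else 0.
have cS : #|{: S}| = #|` S| by rewrite cardfE.
transitivity (\sum_(k < #|` S|.+1) \sum_(X : {set S} | #|X| == k) F #|X|).
  pose r (X : {set S}) : 'I_(#|` S|.+1) := inord #|X|.
  have rE X : r X = #|X| :> nat by rewrite /r inordK // ltnS -cS max_card.
  rewrite (partition_big r predT) //=; apply: eq_bigr => k _.
  by apply: eq_bigl => X; rewrite -(inj_eq val_inj) /= rE.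
transitivity (\sum_(k < #|` S|.+1) F k *+ 'C(#|` S|, k)).
  apply: eq_bigr => k _; rewrite -[X in 'C(X, k)]cS -card_draws -sumr_const.
  by apply: eq_big => [X|X /eqP->//]; rewrite inE.
have := exprBn (1 : int) 1 #|` S|; rewrite subrr expr0n gtn_eqF //=.
case: #|` S| S0 => // n _; rewrite !big_ord_recl /= bin0 bin1 expr1n !mulr1.
rewrite /F /= !mul0rn !add0r expr0 expr1 expr1n mulr1 => /esym E.
(* Restores the terms of sizes 0 and 1, which [F] sets to 0. *)
apply: (addrI (1 - n.+1%:R)).
have -> : 1 - n.+1%:R + (n.+1%:R - 1) = 0 :> int by rewrite addrA subrK subrr.
apply: etrans E; rewrite -addrA expr1n mulr1 mulNrn.
by congr (_ + (_ + _)); apply: eq_bigr => k _; rewrite !expr1n !mulr1.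
Qed.

Lemma sum_pred_count (A : pzSemiRingType) (T : Type) (a : pred T) s :
  \sum_(x <- s) (a x)%:R = (count a s)%:R :> A.
Proof. by rewrite -natr_sum -sumn_count sumnE big_map. Qed.

(** * Towers, their extensions and their signs *)

Section Inversion.
Variables (L : finType) (R : seq (seq L * seq L)).
Local Notation M := (pres_monoid R).
Implicit Types (u v x D : M) (T : seq {fset M}) (J : {fset M}) (m n : nat).

Hypothesis homR : homogeneous R.

Lemma deg1 : deg (1%g : M) = 0%N.
Proof. exact: (@deg_word_class _ R [::]). Qed.

(** Descent on the degree: a common multiple that is not minimal has a proper left divisor which is
    again a common multiple, of smaller degree. *)
Lemma exists_mcm_dvdl J u : (forall j, j \in J -> dvdl j u) ->
  exists2 D, mcm [set` J] D & dvdl D u.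
Proof.
move=> Ju; have [n] := ubnP (deg u); elim: n u Ju => // n IH u Ju un.
have [[v [vJ vu nvu]]|min_u] :=
  pselect (exists v, [/\ cm_r [set` J] v, dvdl v u & v <> u]).
  have [|D mD Dv] := IH v vJ; last by exists D => //; exact: dvdl_trans vu.
  rewrite ltnS in un; apply: leq_trans un; rewrite ltn_neqAle deg_dvdl // andbT.
  by apply/eqP => /(dvdl_deg_eq homR vu).
exists u; last by exists 1%g; rewrite mulg1.
split=> // v vJ vu; apply: contrapT => nvu; by apply: min_u; exists v.
Qed.

Lemma tower_mcm_rcons T J k : (k <= size T)%N ->
  tower_mcm (rcons T J) k = tower_mcm T k.
Proof. by case: k => // k kT; rewrite /tower_mcm nth_rcons kT. Qed.

Lemma tower_top_rcons T J : tower_top (rcons T J) = mcm [set` J].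
Proof. by rewrite /tower_top size_rcons /= nth_rcons ltnn eqxx. Qed.

Lemma tower_mcm_rcons_last T J :
  tower_mcm (rcons T J) (size T).+1 = mcm [set` J].
Proof. by rewrite -(tower_top_rcons T J) /tower_top size_rcons. Qed.

Lemma is_tower_rcons T J : is_tower (rcons T J) <->
  [/\ is_tower T, [set` J] `<=` tower_top T, (1 < #|` J|)%N
    & mcm [set` J] !=set0].
Proof.
have lastE : nth fset0 (rcons T J) (size T) = J by rewrite nth_rcons ltnn eqxx.
split=> [tTJ|[tT JT J1 J0] k].
  have [] := tTJ (size T); first by rewrite size_rcons.
  rewrite tower_mcm_rcons // tower_mcm_rcons_last lastE.
  move=> JT J1 J0; split=> // k kT; have [] := tTJ k.
    by rewrite size_rcons ltnS ltnW.
  by rewrite nth_rcons kT !tower_mcm_rcons // ltnW.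
rewrite size_rcons ltnS leq_eqVlt => /orP[/eqP->|kT].
  by rewrite tower_mcm_rcons // tower_mcm_rcons_last lastE.
by have [] := tT k kT; rewrite nth_rcons kT !tower_mcm_rcons // ltnW.
Qed.

(** Makes the truncated subtraction in [tower_exponent] exact. *)
Lemma size_tower T : is_tower T -> (size T <= \sum_(J <- T) #|` J|)%N.
Proof.
move=> tT; rewrite -sum1_size big_seq [leqRHS]big_seq; apply: leq_sum => J.
by move=> /(nthP fset0)[k kT <-]; have [_ /ltnW] := tT k kT.
Qed.

Local Notation sign T := ((-1) ^+ tower_exponent T : int).

(** Appending [J] raises the exponent by #J - 1. *)
Lemma sign_rcons T J : is_tower (rcons T J) ->
  sign (rcons T J) = - sign T * (-1) ^+ #|` J|.
Proof.
move=> tTJ; have [tT _ J1 _] := (is_tower_rcons T J).1 tTJ.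
rewrite mulNr -exprD -[- (_ ^+ _)]mulN1r -exprS /tower_exponent.
have := size_tower tT; rewrite -cats1 big_cat big_seq1 size_cat /=.
move: (\sum_(_ <- _) _)%N #|` _| J1 => s [//|c] _ sT.
have -> : (s - size T + 1 + c.+1).+1 = (s + c.+1 - (size T + 1) + 1).+2 by lia.
by rewrite !exprS !mulN1r opprK.
Qed.

(** * Towers with a top element dividing a fixed element *)

Definition dvdl_top u T : {fset M} :=
  fset_set (tower_top T `&` [set D | dvdl D u]).

Lemma mem_dvdl_top u T D : D \in dvdl_top u T <-> tower_top T D /\ dvdl D u.
Proof.
rewrite /dvdl_top in_fset_set ?inE //.
apply: sub_finite_set (finite_deg homR (deg u)) => x [_ /=].
exact: deg_dvdl.
Qed.

Lemma dvdl_top_neq0 u T : dvdl_top u T != fset0 <->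
  exists2 D, tower_top T D & dvdl D u.
Proof.
split=> [/fset0Pn[D /mem_dvdl_top[]]|[D TD Du]]; first by exists D.
by apply/fset0Pn; exists D; apply/mem_dvdl_top.
Qed.

(** For u ≠ 1 these are the towers of height [p] with a divisor of [u] in the top. Nonemptiness of
    [mcm] need not be tested, as [u] is a common multiple of [J]. *)
Fixpoint dvdl_towers u p : seq (seq {fset M}) :=
  if p is p'.+1 then
    [seq rcons T J | T <- dvdl_towers u p',
       J <- [seq J <- fpowerset (dvdl_top u T) | (1 < #|` J|)%N]]
  else [:: [::]].

Lemma uniq_dvdl_towers u p : uniq (dvdl_towers u p).
Proof.
elim: p => //= p IH; apply: allpairs_uniq_dep => //.
  by move=> T _; rewrite filter_uniq ?fset_uniq.
by move=> [T J] [T' J'] _ _ /= /rcons_inj[-> ->].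
Qed.

Lemma dvdl_top_nil u : u != 1%g -> dvdl_top u [::] != fset0.
Proof.
move=> u1; apply/dvdl_top_neq0.
case w_def: (pres_word u) => [|l w].
  by case/eqP: u1; rewrite -(pres_wordK u) w_def.
exists (word_class R [:: l]); first by exists l.
by exists (word_class R w); rewrite -word_classM /= -w_def pres_wordK.
Qed.

(** Forwards, some minimal common multiple of [J] divides [u]. Backwards, each element of [J]
    divides a top element dividing [u], so [J] is one of the listed subsets. *)
Lemma mem_dvdl_towers u p T : u != 1%g -> T \in dvdl_towers u p <->
  [/\ is_tower T, size T = p & dvdl_top u T != fset0].
Proof.
move=> u1; elim: p T => [|p IH] T /=.
  rewrite inE; split=> [/eqP->|[_ /size0nil->]//].
  by split=> //; exact: dvdl_top_nil.
split.
  case/allpairsPdep => T' [J [/IH[tT sT T0]]].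
  rewrite mem_filter fpowersetE => /andP[J1 /fsubsetP JT] ->.
  have [|D JD Du] := @exists_mcm_dvdl J u.
    by move=> j /JT/mem_dvdl_top[].
  split; last 2 first.
  - by rewrite size_rcons sT.
  - by apply/dvdl_top_neq0; exists D; rewrite ?tower_top_rcons.
  apply/is_tower_rcons; split=> //; last by exists D.
  by move=> j /JT/mem_dvdl_top[].
case: (lastP T) => [[]//|{}T J] [/is_tower_rcons[tT JT J1 _]].
rewrite size_rcons => -[sT] /dvdl_top_neq0[D]; rewrite tower_top_rcons.
move=> [JD _] Du.
have JTu : (J `<=` dvdl_top u T)%fset.
  apply/fsubsetP => j jJ; apply/mem_dvdl_top; split; first exact: JT.
  by apply: dvdl_trans Du; exact: JD.
apply/allpairsPdep; exists T, J; split=> //.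
  apply/IH; split=> //; have /fset0Pn[j /(fsubsetP JTu) jT] : J != fset0.
    by rewrite -cardfs_gt0 ltnW.
  by apply/fset0Pn; exists j.
by rewrite mem_filter J1 fpowersetE.
Qed.

(** Top elements have degree above the height, so at height deg u none can divide [u]. *)
Lemma dvdl_towers_deg u : u != 1%g -> dvdl_towers u (deg u) = [::].
Proof.
move=> u1; case T_def: (dvdl_towers _ _) => [//|T s].
have /mem_dvdl_towers[//|tT sT] : T \in dvdl_towers u (deg u).
  by rewrite T_def mem_head.
move=> /dvdl_top_neq0[D TD Du].
by have := leq_trans (tower_deg homR tT (leqnn _) TD) (deg_dvdl homR Du);
  rewrite sT ltnn.
Qed.

Lemma sum_sign_dvdl_towersS u p : u != 1%g ->
  \sum_(T <- dvdl_towers u p.+1) sign T =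
  \sum_(T <- dvdl_towers u p) sign T
  - \sum_(T <- dvdl_towers u p) sign T * #|` dvdl_top u T|%:R.
Proof.
move=> u1; rewrite /= big_allpairs_dep /= -sumrB big_seq [RHS]big_seq.
apply: eq_bigr => T Tu.
(* [T0] is the nonemptiness that [sum_sign_fpowerset] requires. *)
have [tT sT T0] := (mem_dvdl_towers p T u1).1 Tu.
rewrite -{1}[sign T]mulr1 -mulrBr -opprB -(sum_sign_fpowerset T0).
rewrite mulrN -mulNr big_distrr /= -[in RHS]big_filter big_seq [RHS]big_seq.
apply: eq_bigr => J JT; apply: sign_rcons.
have : rcons T J \in dvdl_towers u p.+1.
  by apply/allpairsPdep; exists T, J.
by case/mem_dvdl_towers.
Qed.

Lemma sum_sign_dvdl_towers u : u != 1%g ->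
  \sum_(p < deg u) \sum_(T <- dvdl_towers u p)
    sign T * #|` dvdl_top u T|%:R = -1.
Proof.
move=> u1; pose B p := \sum_(T <- dvdl_towers u p) sign T.
transitivity (\sum_(0 <= p < deg u) (B p - B p.+1)).
  rewrite big_mkord; apply: eq_bigr => p _.
  by rewrite /B sum_sign_dvdl_towersS // subKr.
rewrite (@telescope_sumr_eq _ _ _ (fun p => - B p)) // => [|p _]; last first.
  by rewrite opprK addrC.
(* No tower is left at the upper end; at the lower end the empty tower has exponent 1, so [B 0] is
   -1. *)
rewrite opprK {1}/B dvdl_towers_deg // big_nil oppr0 add0r.
by rewrite /B big_seq1 /tower_exponent big_nil.
Qed.

(** * Finite truncations and the coefficients of the product *)

Definition deg_set n : {fset M} := fset_set [set x | deg x = n].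

Lemma mem_deg_set n x : (x \in deg_set n) = (deg x == n).
Proof.
rewrite in_fset_set ?inE; first by apply/asboolP/eqP.
by apply: sub_finite_set (finite_deg homR n) => y /= ->.
Qed.

Definition deg_le_set n : {fset M} := fset_set [set x | (deg x <= n)%N].

Lemma mem_deg_le_set n x : (x \in deg_le_set n) = (deg x <= n)%N.
Proof.
rewrite in_fset_set; last exact: (finite_deg homR).
by apply/idP/idP => [/set_mem|/mem_set].
Qed.

Definition towers_le n : {fset seq {fset M}} :=
  fset_set [set T | Tmcm T /\ exists2 D, tower_top T D & (deg D <= n)%N].

Lemma mem_towers_le n T : T \in towers_le n <->
  is_tower T /\ exists2 D, tower_top T D & (deg D <= n)%N.
Proof.
rewrite in_fset_set; last exact: (finite_Tmcm_deg homR).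
by split=> [/set_mem|?]; [|exact: mem_set].
Qed.

Definition growth n : int := #|` deg_set n|%:R.

Lemma deg_set0 : deg_set 0 = [fset 1%g]%fset.
Proof.
apply/fsetP => x; rewrite mem_deg_set inE.
by apply/eqP/eqP => [/deg_eq0 //|->]; exact: deg1.
Qed.

Definition top_count T n : int :=
  \sum_(D \in tower_top T) ((deg D == n)%:R : int).

(** A bound [m] independent of [n] gives all coefficients up to [m] the same index list, so that
    sums can be exchanged. *)
Lemma top_countE T n m : (n <= m)%N ->
  top_count T n = \sum_(D <- deg_le_set m)
    (D \in tower_top T)%:R * (deg D == n)%:R.
Proof.
move=> nm.
rewrite /top_count (fsbigE [seq D <- deg_le_set m | D \in tower_top T]) //=.
- rewrite big_filter_cond [RHS]big_mkcond /= big_mkcond /=.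
  apply: eq_bigr => D _; rewrite andbb.
  by case: (_ \in _); rewrite (mul1r, mul0r).
- by rewrite filter_uniq.
- by move=> D /=; rewrite mem_filter => /andP[/set_mem].
move=> D TD; rewrite mem_filter mem_set //= mem_deg_le_set -ltnNge => mD.
by rewrite gtn_eqF //; exact: leq_ltn_trans mD.
Qed.

Lemma skew_growthE m n : (n <= m)%N -> skew_growth R n = (n == 0%N)%:R +
  \sum_(T <- towers_le m)
    sign T * top_count T n.
Proof.
move=> nm; congr (_ + _); rewrite (fsbigE (towers_le m)) //=.
- rewrite big_seq_cond [RHS]big_seq; apply: eq_bigl => T.
  by apply/andb_idr => /mem_towers_le[tT _]; exact: mem_set.
- by move=> T /mem_towers_le[].
(* A tower outside [towers_le m] has no top element of degree [n]. *)
move=> T tT TF; rewrite fsbig1 ?mulr0 // => D TD; case: eqP => // Dn.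
by case/negP: TF; apply/mem_towers_le; split=> //; exists D => //; rewrite Dn.
Qed.

Hypothesis cancelM : forall x : M, injective (fun y => (x * y)%g).

(** By cancellation, left multiplication by [D] is a bijection from the elements of degree m - deg D
    onto the multiples of [D] of degree [m]. *)
Lemma card_deg_multiples D m : (deg D <= m)%N ->
  growth (m - deg D) = \sum_(u <- deg_set m) `[< dvdl D u >]%:R.
Proof.
move=> Dm; set E := deg_set (m - deg D); rewrite /growth.
have -> : #|` E| = #|` [fset (D * x)%g | x in E]%fset|.
  by rewrite card_imfset //=; exact: cancelM.
rewrite (sum_pred_count _ (fun u => `[< dvdl D u >])); congr _%:R.
rewrite -size_filter; apply: perm_size; apply: uniq_perm.
- exact: fset_uniq.
- by rewrite filter_uniq ?fset_uniq.
move=> u; rewrite mem_filter mem_deg_set; apply/imfsetP/andP => /=.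
  move=> [x]; rewrite mem_deg_set => /eqP xD ->.
  by rewrite degM // xD subnKC //; split=> //; apply/asboolP; exists x.
move=> [/asboolP[x ->]]; rewrite degM // => /eqP Dxm.
by exists x; rewrite // mem_deg_set -Dxm addKn.
Qed.

Lemma card_dvdl_top u T : #|` dvdl_top u T|%:R =
  \sum_(D <- deg_le_set (deg u))
    (D \in tower_top T)%:R * `[< dvdl D u >]%:R :> int.
Proof.
under eq_bigr => D _ do rewrite -natrM mulnb.
rewrite (sum_pred_count _
  (fun D => (D \in tower_top T) && `[< dvdl D u >])); congr _%:R.
rewrite -size_filter; apply: perm_size; apply: uniq_perm.
- exact: fset_uniq.
- by rewrite filter_uniq ?fset_uniq.
move=> D; rewrite mem_filter mem_deg_le_set.
apply/idP/idP => [/mem_dvdl_top[TD Du]|].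
  by rewrite mem_set //= asboolT //=; exact: deg_dvdl.
by case/andP => /andP[/set_mem TD /asboolP Du] _; apply/mem_dvdl_top.
Qed.

(** Both sides count the pairs (D, u) with D in |T| dividing u and deg u = m. *)
Lemma top_count_convolution T m :
  \sum_(i < m.+1) top_count T i * growth (m - i) =
  \sum_(u <- deg_set m) #|` dvdl_top u T|%:R.
Proof.
transitivity
    (\sum_(D <- deg_le_set m) (D \in tower_top T)%:R * growth (m - deg D)).
  under eq_bigr => i _ do
    rewrite (top_countE T (ltn_ord i : (i <= m)%N)) mulr_suml.
  rewrite exchange_big /= big_seq [RHS]big_seq; apply: eq_bigr => D.
  rewrite mem_deg_le_set => Dm.
  have Dm1 : (deg D < m.+1)%N by [].
  (* Only the index i = deg D survives. *)
  rewrite (bigD1 (Ordinal Dm1)) //= eqxx mulr1 big1 ?addr0 // => i iD.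
  rewrite [_ == _ :> nat]eq_sym.
  by rewrite -(inj_eq val_inj) /= in iD; rewrite (negbTE iD) mulr0 mul0r.
transitivity (\sum_(D <- deg_le_set m) \sum_(u <- deg_set m)
    (D \in tower_top T)%:R * `[< dvdl D u >]%:R : int).
  rewrite big_seq [RHS]big_seq; apply: eq_bigr => D.
  by rewrite mem_deg_le_set => Dm; rewrite card_deg_multiples // mulr_sumr.
rewrite exchange_big /= big_seq [RHS]big_seq.
apply: eq_bigr => u; rewrite mem_deg_set => /eqP um.
by rewrite card_dvdl_top um.
Qed.

(** Carries [sum_sign_dvdl_towers] to an index set depending only on deg u, as the exchange of sums
    over [u] requires; the additional towers have an empty [dvdl_top]. *)
Lemma sum_sign_tower_top u : u != 1%g ->
  \sum_(T <- towers_le (deg u))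
    sign T * #|` dvdl_top u T|%:R = -1.
Proof.
move=> u1; rewrite -[RHS](sum_sign_dvdl_towers u1).
transitivity (\sum_(p < deg u) \sum_(T <- towers_le (deg u) | size T == p)
    sign T * #|` dvdl_top u T|%:R); last first.
  apply: eq_bigr => p _.
  rewrite (bigID (fun T => dvdl_top u T != fset0)) /= [X in _ + X]big1 ?addr0.
    rewrite -big_filter; apply: perm_big; apply: uniq_perm.
    - by rewrite filter_uniq ?fset_uniq.
    - exact: uniq_dvdl_towers.
    move=> T; rewrite mem_filter.
    apply/idP/idP => [|/(mem_dvdl_towers p T u1)[tT sT T0]].
      case/andP => /andP[/eqP sT T0] /mem_towers_le[tT _].
      exact/mem_dvdl_towers.
    rewrite sT eqxx T0 /=; apply/mem_towers_le; split=> //.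
    have /dvdl_top_neq0[D TD Du] := T0.
    by exists D => //; exact: deg_dvdl.
  by move=> T /andP[_ /negbNE/eqP->]; rewrite cardfs0 mulr0.
under [RHS]eq_bigr => p _ do rewrite big_mkcond.
rewrite exchange_big /= big_seq [RHS]big_seq; apply: eq_bigr => T.
move=> /mem_towers_le[tT [D TD Du]].
have sT : (size T < deg u)%N by exact: leq_trans (tower_deg homR tT _ TD) Du.
rewrite [RHS](bigD1 (Ordinal sT)) //= eqxx big1 ?addr0 // => p pT.
by rewrite -(inj_eq val_inj) /= eq_sym in pT; rewrite (negbTE pT).
Qed.

(** The coefficient at [m] is a sum over the u of degree [m] of 1 plus the signed number of pairs
    (T, D) with D dividing u, which is 1 - 1 = 0 unless u = 1. *)
Lemma skew_growth_inversion :
  fps_mul (skew_growth R) growth = fps_of_poly 1.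
Proof.
apply/funext => m; rewrite /fps_mul /fps_of_poly coef1.
under eq_bigr => i _ do
  rewrite (skew_growthE (ltn_ord i : (i <= m)%N)) mulrDl mulr_suml.
rewrite big_split big_ord_recl mul1r subn0 big1 ?addr0 => [|i _]; last first.
  by rewrite mul0r.
rewrite exchange_big /=.
under [X in _ + X]eq_bigr => T _.
  under eq_bigr => i _ do rewrite -mulrA.
  rewrite -mulr_sumr top_count_convolution mulr_sumr.
  over.
rewrite exchange_big /= {1}/growth -sum1_size natr_sum addr0 -big_split /=.
transitivity (\sum_(u <- deg_set m) ((u == 1%g)%:R : int)).
  rewrite big_seq [RHS]big_seq; apply: eq_bigr => u.
  rewrite mem_deg_set => /eqP <-; case: (eqVneq u 1%g) => [->|u1].
    (* Top elements have positive degree, so [towers_le 0] is empty. *)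
    rewrite big_seq big1 ?addr0 // => T; rewrite mem_towers_le => -[tT [D TD]].
    by rewrite deg1 leqNgt (leq_ltn_trans _ (tower_deg homR tT _ TD)).
  by rewrite sum_sign_tower_top // subrr.
have [->|m0] := eqVneq m 0%N; first by rewrite deg_set0 big_seq_fset1 eqxx.
rewrite big_seq big1 // => u; rewrite mem_deg_set => /eqP um.
by case: eqP um => // -> /esym; rewrite deg1 => /eqP; rewrite (negbTE m0).
Qed.

End Inversion.

(** * Normal forms and left cancellation in B_ii *)

Section Bii.
Local Notation M := (pres_monoid Bii_relations).
Local Notation coord := (nat * (nat * (nat * nat)))%type.
Implicit Types (x y z : M) (l : 'I_3) (s : coord) (w : seq 'I_3).

(** In the enveloping group, [k] is the exponent of the third conjugate b a b^-1: a^i c^j b a^k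
    b^(n-1) = a^i c^j (b a b^-1)^k b^n. *)
Definition act_gen l s : coord :=
  let: (i, (j, (k, n))) := s in
  if l == gen_a then (i.+1, (j, (k, n)))
  else if l == gen_b then (j, (k, (i, n.+1)))
  else (i, (j.+1, (k, n))).

Definition act w s : coord := foldr act_gen s w.

Lemma act_gen_inj l : injective (act_gen l).
Proof.
move=> [i [j [k n]]] [i' [j' [k' n']]] /=.
by case: ifP => _; [|case: ifP => _]; case=> -> -> -> ->.
Qed.

Lemma act_inj w : injective (act w).
Proof. by elim: w => //= l w IH s s' /act_gen_inj/IH. Qed.

Lemma act_congr u v : congr_gen Bii_relations u v -> act u =1 act v.
Proof.
elim=> {u v} [u v|//|u v _ uv s|v u w _ uv _ vw s|u u' v v' _ uu' _ vv' s].
- by rewrite !inE => /or3P[] /eqP[-> ->] [i [j [k n]]].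
- by rewrite uv.
- by rewrite uv vw.
by rewrite /act !foldr_cat -/(act v s) vv' -/(act u _) uu'.
Qed.

Definition coords x : coord := act (pres_word x) (0, (0, (0, 0)))%N.

Lemma coordsM x y : coords (x * y)%g = act (pres_word x) (coords y).
Proof. by rewrite /coords (act_congr (congr_gen_word _ _)) /act foldr_cat. Qed.

Local Notation gen l := (word_class Bii_relations [:: l] : M).

Lemma coords_gen l y : coords (gen l * y)%g = act_gen l (coords y).
Proof. by rewrite coordsM (act_congr (congr_gen_word _ _)). Qed.

Lemma coords1 : coords 1%g = (0, (0, (0, 0)))%N.
Proof. exact: (act_congr (congr_gen_word _ _)). Qed.

Definition nf s : M :=
  let: (i, (j, (k, n))) := s in
  (gen gen_a ^+ i * (gen gen_c ^+ j *
    if n is n'.+1 then gen gen_b * (gen gen_a ^+ k * gen gen_b ^+ n')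
    else 1))%g.

(** At n = 0 the value of [nf] does not depend on [k]; forcing k = 0 there makes the normal form
    unique. *)
Definition valid s : bool :=
  let: (i, (j, (k, n))) := s in (n == 0%N) ==> (k == 0%N).

Definition total s : nat := let: (i, (j, (k, n))) := s in (i + j + k + n)%N.

Lemma genM_ac : (gen gen_a * gen gen_c = gen gen_c * gen gen_a)%g.
Proof. by rewrite -!word_classM; apply/word_classP/congr_gen_rel. Qed.

Lemma genM_ab : (gen gen_a * gen gen_b = gen gen_b * gen gen_c)%g.
Proof. by rewrite -!word_classM; apply/word_classP/congr_gen_rel. Qed.

Lemma genM_cbb :
  (gen gen_c * (gen gen_b * gen gen_b) = gen gen_b * gen gen_b * gen gen_a)%g.
Proof. by rewrite -!word_classM; apply/word_classP/congr_gen_rel. Qed.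

(** Each defining relation has the form p q = q r, with q one of c, b, b b; powers thus cross q
    without inverses. *)
Lemma semiconjX (N : monoidType) (p q r : N) n :
  (p * q = q * r -> p ^+ n * q = q * r ^+ n)%g.
Proof.
move=> pqr; elim: n => [|n IH]; first by rewrite !expg0 mulg1 mul1g.
by rewrite !expgS -mulgA IH mulgA pqr mulgA.
Qed.

Lemma commXX_ac i j :
  (gen gen_a ^+ i * gen gen_c ^+ j = gen gen_c ^+ j * gen gen_a ^+ i)%g.
Proof. by apply/semiconjX/esym/semiconjX/esym/genM_ac. Qed.

Lemma nf_act_gen l s : valid s -> nf (act_gen l s) = (gen l * nf s)%g.
Proof.
case: s => i [j [k n]] /= v.
have abX m : (gen gen_a ^+ m * gen gen_b = gen gen_b * gen gen_c ^+ m)%g.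
  exact/semiconjX/genM_ab.
have cbbX m : (gen gen_c ^+ m * (gen gen_b * gen gen_b) =
    gen gen_b * gen gen_b * gen gen_a ^+ m)%g.
  exact/semiconjX/genM_cbb.
have [->|la] := eqVneq l gen_a; first by rewrite /= expgS -mulgA.
have [->|lb] := eqVneq l gen_b; last first.
  have -> : l = gen_c by apply: val_inj; case: l la lb => -[|[|[|]]].
  by rewrite /= expgS !mulgA -[in RHS](expg1 (gen gen_c)) -commXX_ac expg1.
(* For n = 0 the claim is b a^i c^j = b c^j a^i = a^j b a^i. *)
case: n v => [/eqP ->|n _].
  by rewrite /= !expg0 !mulg1 mul1g commXX_ac [RHS]mulgA -abX !mulgA.
have bbc m y : (gen gen_b * (gen gen_b * (gen gen_a ^+ m * y)) =
    gen gen_c ^+ m * (gen gen_b * (gen gen_b * y)))%g.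
  by rewrite ![in LHS]mulgA -cbbX !mulgA.
have bc m y : (gen gen_b * (gen gen_c ^+ m * y) =
    gen gen_a ^+ m * (gen gen_b * y))%g.
  by rewrite !mulgA abX.
have ac m m' y : (gen gen_a ^+ m * (gen gen_c ^+ m' * y) =
    gen gen_c ^+ m' * (gen gen_a ^+ m * y))%g.
  by rewrite !mulgA commXX_ac.
(* The chain is b a^i c^j b a^k b^n = a^j b a^i b a^k b^n = a^j b b a^k c^i b^n = a^j c^k b b c^i
   b^n = a^j c^k b a^i b^(n+1). *)
by rewrite /= [in RHS]ac bc -(bc i) -ac bbc bc -expgS.
Qed.

Lemma valid_act_gen l s : valid s -> valid (act_gen l s).
Proof. by case: s => i [j [k n]] /=; case: ifP => // _; case: ifP. Qed.

Lemma valid_coords x : valid (coords x).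
Proof. by rewrite /coords; elim: (pres_word x) => // l w /valid_act_gen ->. Qed.

Lemma coordsK : cancel coords nf.
Proof.
move=> x; rewrite -[RHS]pres_wordK /coords.
have : valid (act (pres_word x) (0, (0, (0, 0)))%N) := valid_coords x.
elim: (pres_word x) => [|l w IH] _; first by rewrite /= !expg0 !mulg1.
have vw : valid (act w (0, (0, (0, 0)))%N).
  by elim: w {IH} => // l' w /valid_act_gen ->.
by rewrite /= nf_act_gen // IH // -word_classM.
Qed.

(** Words act injectively on coordinates, and [nf] recovers an element from its coordinates. *)
Lemma Bii_cancel x : injective (fun y => (x * y)%g).
Proof.
move=> y z /= /(congr1 coords); rewrite !coordsM => /act_inj yz.
by rewrite -(coordsK y) yz coordsK.
Qed.

(** With [coordsK] this identifies the monoid with the valid quadruples, which reduces the growth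
    series to a count of quadruples. *)
Lemma nfK s : valid s -> coords (nf s) = s.
Proof.
have cX l y m : coords (gen l ^+ m * y)%g = iter m (act_gen l) (coords y).
  by elim: m => [|m IH]; rewrite ?expg0 ?mul1g // expgS -mulgA coords_gen IH.
case: s => i [j [k n]] v.
have aX m p q : iter m (act_gen gen_a) (p, q) = (m + p, q)%N.
  by case: q => ? [? ?]; elim: m => //= m ->.
have bX m : iter m (act_gen gen_b) (0, (0, (0, 0)))%N = (0, (0, (0, m)))%N.
  by elim: m => //= m ->.
have gcX m p q r : iter m (act_gen gen_c) (p, (q, r)) = (p, (m + q, r))%N.
  by case: r => ? ?; elim: m => //= m ->.
rewrite /nf !cX; case: n v => [|n] v.
  by rewrite coords1 gcX aX !addn0; case: k v.
by rewrite coords_gen cX -[(_ ^+ n)%g]mulg1 cX coords1 bX aX /= gcX aX !addn0.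
Qed.

Lemma total_act_gen l s : total (act_gen l s) = (total s).+1.
Proof.
case: s => i [j [k n]] /=.
by case: ifP => _; [|case: ifP => _] => /=; lia.
Qed.

Lemma total_coords x : total (coords x) = deg x.
Proof.
rewrite /coords /deg; elim: (pres_word x) => //= l w <-.
exact: total_act_gen.
Qed.

(** * Counting normal forms by degree *)

Definition add_coord (T : Type) (f : nat -> seq T) m : seq (nat * T) :=
  [seq (i, t) | i <- iota 0 m.+1, t <- f (m - i)%N].

Lemma mem_add_coord (T : eqType) (f : nat -> seq T) m i t :
  ((i, t) \in add_coord f m) = (i <= m)%N && (t \in f (m - i)%N).
Proof.
apply/allpairsPdep/andP => [[i' [t' [+ + [-> ->]]]]|[im tf]].
  by rewrite mem_iota.
by exists i, t; rewrite mem_iota.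
Qed.

Lemma uniq_add_coord (T : eqType) (f : nat -> seq T) m :
  (forall r, uniq (f r)) -> uniq (add_coord f m).
Proof.
move=> uf; apply: allpairs_uniq_dep => //; first exact: iota_uniq.
by move=> [i t] [i' t'] _ _ /= [-> ->].
Qed.

(** A free coordinate divides the generating series by 1 - X. *)
Lemma size_add_coord (T : Type) (f : nat -> seq T) :
  (fun m => (size (add_coord f m))%:R) =
  partial_sums (fun m => (size (f m))%:R : int).
Proof.
apply/funext => m; rewrite size_allpairs_dep sumnE big_map natr_sum.
by rewrite -[iota 0 _]/(index_iota 0 m.+1) big_mkord.
Qed.

(** For r > 0 the pair (r, 0) is not valid, so [k] stops at r - 1. *)
Definition bii_tails r : seq (nat * nat) :=
  if r is 0 then [:: (0, 0)%N] else [seq (k, r - k)%N | k <- iota 0 r].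

Lemma mem_bii_tails r k n :
  ((k, n) \in bii_tails r) = (k + n == r)%N && ((n == 0%N) ==> (k == 0%N)).
Proof.
case: r => [|r]; first by rewrite inE -pair_eqE /=; lia.
apply/mapP/andP => [[k' + [-> ->]]|[/eqP kn v]].
  by rewrite mem_iota; lia.
by exists k; rewrite ?mem_iota -?kn ?addKn //; lia.
Qed.

Lemma uniq_bii_tails r : uniq (bii_tails r).
Proof. by case: r => // r; rewrite map_inj_uniq ?iota_uniq // => ? ? []. Qed.

Lemma size_bii_tails r : size (bii_tails r) = (r + (r == 0))%N.
Proof. by case: r => // r; rewrite size_map size_iota addn0. Qed.

Definition bii_coords m : seq coord := add_coord (add_coord bii_tails) m.

Lemma mem_bii_coords m s : (s \in bii_coords m) = valid s && (total s == m).
Proof.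
case: s => i [j [k n]]; rewrite !mem_add_coord mem_bii_tails /=.
by lia.
Qed.

(** The free coordinates [i] and [j] give the two partial sums; the inner sequence 1, 1, 2, 3, ...
    counts the pairs (k, n). *)
Lemma growth_Bii :
  growth Bii_relations = partial_sums (partial_sums
    (fun m => (m + (m == 0))%:R : int)).
Proof.
have -> : (fun m => (m + (m == 0))%:R : int) = fun m => (size (bii_tails m))%:R.
  by apply/funext => m; rewrite size_bii_tails.
rewrite -!size_add_coord; apply/funext => m; congr _%:R.
rewrite -(size_map nf); apply: perm_size; apply: uniq_perm.
- exact: fset_uniq.
- rewrite map_inj_in_uniq.
    by do 2!apply: uniq_add_coord => ?; exact: uniq_bii_tails.
  move=> s s'; rewrite !mem_bii_coords => /andP[vs _] /andP[vs' _].
  by move=> /(congr1 coords); rewrite !nfK.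
move=> x; rewrite mem_deg_set //; apply/eqP/mapP => [xm|[s + ->]].
  exists (coords x); rewrite ?coordsK // mem_bii_coords valid_coords.
  by rewrite total_coords xm /=.
by rewrite mem_bii_coords => /andP[vs /eqP <-]; rewrite -total_coords nfK.
Qed.

Lemma growth_Bii_fps :
  fps_mul (growth Bii_relations) (fps_of_poly ((1 - 'X) ^+ 4)) =
  fps_of_poly (1 - 'X + 'X ^+ 2).
Proof.
rewrite fps_mulC growth_Bii.
rewrite (_ : (1 - 'X) ^+ 4 = (1 - 'X) * ((1 - 'X) * ((1 - 'X) * (1 - 'X)))) //.
rewrite -!fps_mul_of_poly -!fps_mulA !fps_mul_partial_sums.
(* Two factors 1 - X have undone the partial sums; the other two take the second difference of 1, 1,
   2, 3, ..., which is 1, -1, 1, 0, 0, .... *)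
apply/funext => -[|[|[|n]]];
  rewrite ?fps_mul_sub1XS ?fps_mul_sub1X0 /fps_of_poly !coefE //=.
by rewrite !addn0; lia.
Qed.
End Bii.

Theorem mainTheorem1 :
  skew_growth Bii_relations =
  fps_div (fps_of_poly ((1 - 'X) ^+ 4)) (fps_of_poly (1 - 'X + 'X ^+ 2)).
Proof.
(* With N the skew growth, P the growth and q the denominator, N = N q q^-1 = (N P) (1 - X)^4 q^-1,
   and N P = 1. *)
rewrite -[LHS]fps_mul1f fps_mulC -fps_mul_Bii_denom fps_mulA -growth_Bii_fps.
rewrite fps_mulA skew_growth_inversion ?fps_mul1f //.
exact: Bii_cancel.
Qed.
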